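(* Let $d,l$ be positive integers, and let $f$ be the maximum number of Hadamard matrices of order $d$ that are mutually quasi-unbiased for parameters $(d,l,a)$. Then upper bounds on $f$ are given by the following table. Its columns are the previously known bound, the first linear programming bound (LP1), the second linear programming bound (LP2), and the semidefinite programming bound (SDP). A dash marks a blank entry. $$\begin{array}{|c|c|c|c|c|} \hline (d,l,a) & \text{previously known} & \text{LP1} & \text{LP2} & \text{SDP}\\ \hline (16,4,64) & f\le 35 & - & f\le 15 & f\le 15\\ (24,4,144) & f\le 85 & - & f\le 27 & f\le 25\\ (24,9,64) & f\le 85 & f\le 208 & - & f\le 95\\ (32,4,256) & f\le 155 & - & f\le 63 & f\le 47\\ (36,9,144) & f\le 199 & - & f\le 80 & f\le 79\\ (40,4,400) & f\le 247 & - & - & f\le 101\\ (40,25,64) & f\le 28 & f\le 30 & - & f\le 30\\ (48,4,576) & f\le 361 & - & - & f\le 276\\ (48,9,256) & f\le 361 & - & f\le 105 & f\le 104\\ (48,16,144) & f\le 361 & - & - & f\le 316\\ (48,36,64) & f\le 28 & f\le 30 & - & f\le 30\\ \hline \end{array}$$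
   Context: A Hadamard matrix of order $d$ is a $d\times d$ matrix $H$ with entries $\pm1$ such that $HH^\top=dI$. A weighing matrix of order $d$ and weight $k$ is a $d\times d$ matrix $W$ with entries in $\{0,1,-1\}$ such that $WW^\top=kI$. Two Hadamard matrices $H_1,H_2$ of order $d$ are quasi-unbiased for parameters $(d,l,a)$ if $(1/\sqrt a)H_1H_2^\top$ is a weighing matrix of weight $l$ (so $l=d^2/a$). Hadamard matrices $H_1,\dots,H_f$ of order $d$ are mutually quasi-unbiased for parameters $(d,l,a)$ if any two distinct ones among them are quasi-unbiased for these parameters. The normalized rows of such matrices give a spherical three-distance set $X\subset S^{d-1}$ with $|X|=df$ and inner product set $\{\pm\alpha,0\}$, where $\alpha=1/\sqrt l$. Columns of the table: - Previously known: bounds from earlier literature, derived from the absolute bound for self-complementary codes or from linear programming for the binary Hamming schemes. - LP1: if $(d+4)\alpha^2\le 6$ and $(d+2)\alpha^2<3$, then $|X|\le d(d+2)\frac{1-\alpha^2}{3-(d+2)\alpha^2}$. - LP2: if $(d+6)(d+8)\alpha^4-15(d+6)\alpha^2+45\le 0$ and $(d+4)(d+8)\alpha^4-15(d+4)\alpha^2+30<0$, then $|X|\le d(d+4)\frac{(1-\alpha^2)(15-(d+8)(1+\alpha^2))}{(d+4)(d+8)\alpha^4-15(d+4)\alpha^2+30}$. - SDP: bounds from the known semidefinite programming method for real spherical three-distance sets, applied with inner products $\{\pm1/\sqrt l,0\}$ and both truncation parameters (of the linear and of the semidefinite constraints) equal to $5$. A blank entry in LP1 or LP2 means that the corresponding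 conditions are not satisfied. *)

(* Defs.v *)
From mathcomp Require Import all_boot all_order all_algebra.
From mathcomp Require Import reals.

Set Implicit Arguments.
Unset Strict Implicit.
Unset Printing Implicit Defensive.

Import Order.TTheory GRing.Theory Num.Theory.
Local Open Scope ring_scope.

Definition hadamard (R : realType) (d : nat) (H : 'M[R]_d) : Prop :=
  (forall i j, H i j = 1 \/ H i j = -1) /\ H *m H^T = (d%:R)%:M.

Definition weighing (R : realType) (d k : nat) (W : 'M[R]_d) : Prop :=
  (forall i j, [\/ W i j = 0, W i j = 1 | W i j = -1]) /\ W *m W^T = (k%:R)%:M.

(* The two matrices are themselves required to be Hadamard in
   [mutually_quasi_unbiased]. *)
Definition quasi_unbiased (R : realType) (d l a : nat) (H1 H2 : 'M[R]_d) : Prop :=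
  weighing l ((Num.sqrt a%:R)^-1 *: (H1 *m H2^T)).

(* A duplicate-free sequence, so that [size Hs] counts matrices. *)
Definition mutually_quasi_unbiased (R : realType) (d l a : nat)
    (Hs : seq 'M[R]_d) : Prop :=
  [/\ uniq Hs,
      {in Hs, forall H, hadamard H}
    & {in Hs &, forall H1 H2, H1 != H2 -> quasi_unbiased l a H1 H2}].

Definition max_quasi_unbiased (R : realType) (d l a f : nat) : Prop :=
  (exists2 Hs : seq 'M[R]_d, mutually_quasi_unbiased l a Hs & size Hs = f) /\
  (forall Hs : seq 'M[R]_d, mutually_quasi_unbiased l a Hs -> (size Hs <= f)%N).

(* The linear programming bounds on [|X|], for [X] in the unit sphere of
   dimension [d - 1] with inner products [alpha], [- alpha] and [0]. *)
Definition LP1_cond (R : realType) (d alpha : R) : bool :=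
  ((d + 4) * alpha ^+ 2 <= 6) && ((d + 2) * alpha ^+ 2 < 3).

Definition LP1_bound (R : realType) (d alpha : R) : R :=
  d * (d + 2) * ((1 - alpha ^+ 2) / (3 - (d + 2) * alpha ^+ 2)).

Definition LP2_cond (R : realType) (d alpha : R) : bool :=
  ((d + 6) * (d + 8) * alpha ^+ 4 - 15 * (d + 6) * alpha ^+ 2 + 45 <= 0) &&
  ((d + 4) * (d + 8) * alpha ^+ 4 - 15 * (d + 4) * alpha ^+ 2 + 30 < 0).

Definition LP2_bound (R : realType) (d alpha : R) : R :=
  d * (d + 4) *
  ((1 - alpha ^+ 2) * (15 - (d + 8) * (1 + alpha ^+ 2)) /
   ((d + 4) * (d + 8) * alpha ^+ 4 - 15 * (d + 4) * alpha ^+ 2 + 30)).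

(* Since [|X| = d * f] and [alpha = 1 / sqrt l], a bound [B] on [|X|] gives the
   bound [floor (B / d)] on [f]; [None] is a blank entry. *)
Definition LP1_entry (R : realType) (d l : nat) : option nat :=
  let alpha : R := (Num.sqrt l%:R)^-1 in
  if LP1_cond d%:R alpha then Some (Num.truncn (LP1_bound d%:R alpha / d%:R))
  else None.

Definition LP2_entry (R : realType) (d l : nat) : option nat :=
  let alpha : R := (Num.sqrt l%:R)^-1 in
  if LP2_cond d%:R alpha then Some (Num.truncn (LP2_bound d%:R alpha / d%:R))
  else None.

(* Columns: d, l, a, previously known, LP1, LP2, SDP. *)
Definition bound_table :
    seq (nat * nat * nat * nat * option nat * option nat * nat) :=
  [:: (16, 4, 64, 35, None, Some 15, 15);
      (24, 4, 144, 85, None, Some 27, 25);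
      (24, 9, 64, 85, Some 208, None, 95);
      (32, 4, 256, 155, None, Some 63, 47);
      (36, 9, 144, 199, None, Some 80, 79);
      (40, 4, 400, 247, None, None, 101);
      (40, 25, 64, 28, Some 30, None, 30);
      (48, 4, 576, 361, None, None, 276);
      (48, 9, 256, 361, None, Some 105, 104);
      (48, 16, 144, 361, None, None, 316);
      (48, 36, 64, 28, Some 30, None, 30)]%N.

(* Main.v *)
Require Import Defs.
From mathcomp Require Import all_boot all_order all_algebra.
From mathcomp Require Import reals ring lra.

(** Every bound on [f] comes from the [d * f] rows of the matrices, seen as
    points of the cube {1, -1}^d. Their distance distribution is known up to sign.
    A row [x] of one matrix is orthogonal to the other rows of that matrix. In
    every other matrix exactly [l] rows have inner product [sqrt a] or
    [- sqrt a] with [x], because the rows of a weighing matrix have square norm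
    [l], and the remaining [d - l] rows are orthogonal to [x].

    The characters of degree [k] of the cube are the monomials
    [\prod_(i in S) x i] with [#|S| = k]. The sum of the products
    [chi x * chi y] over these characters is the [k]-th elementary symmetric
    function of the pointwise product of [x] and [y]. This is a positive
    semidefinite kernel ([elem_sym_psd]), and for even [k] it is a polynomial
    [phi] in the square of the inner product of [x] and [y], namely a Krawtchouk
    polynomial ([elem_sym4], [elem_sym6]). Summing the kernel over all pairs of
    rows gives the Delsarte inequality
      [0 <= phi (d^2) + (d - 1) phi 0 + (f - 1) (l phi a + (d - l) phi 0)]
    ([delsarte]), which bounds [f] as soon as the coefficient of [f - 1] is
    negative. Degree 4 or degree 6 achieves this in all rows of the table but
    one, and the resulting bound is at most each of the bounds in that row.

    The exception is [(d, l, a) = (48, 4, 576)], where both coefficients are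
    nonnegative. Weight 4 is special: a row [x] of the first matrix is half a
    signed sum of four rows of any other matrix. At a given coordinate [p], one
    of these four signed rows must disagree with [x], since otherwise the half
    sum would be [2 * x p]. This selects from each other matrix a vector [v]
    with [v * x = d / 2] and [v p = - x p]. Two such vectors differ from [x] in
    a common coordinate, which forces their inner product to be positive, hence
    equal to [d / 2]. Vectors of square norm [d] with all mutual inner products
    [d / 2] are linearly independent, so [f - 1 <= d] ([weight4_bound]). *)

Set Implicit Arguments.
Unset Strict Implicit.
Unset Printing Implicit Defensive.

Import Order.TTheory GRing.Theory Num.Theory.
Local Open Scope ring_scope.

(** * Elementary symmetric functions of signs *)

Definition elem_sym (R : comNzRingType) (d k : nat) (w : 'I_d -> R) : R :=
  \sum_(S : {set 'I_d} | #|S| == k) \prod_(i in S) w i.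

Lemma elem_sym_coef (R : comNzRingType) (d k : nat) (w : 'I_d -> R) :
  elem_sym k w = (\prod_i (1 + w i *: 'X))`_k.
Proof.
under eq_bigr do rewrite addrC.
rewrite bigA_distr /= coef_sum /elem_sym big_mkcond; apply: eq_bigr => S _.
rewrite -big_mkcond /= scaler_prod prodr_const coefZ coefXn eq_sym.
by case: eqP; rewrite ?mulr1 ?mulr0.
Qed.

(** The logarithmic derivative of the generating polynomial is the sum of the
    [w / (1 + w 'X)], and [w / (1 + w 'X) = (w - 'X) / (1 - 'X^2)] when
    [w ^+ 2 = 1]. *)
Lemma sign_prod_deriv (R : comNzRingType) (s : seq R) :
  all (fun w => w ^+ 2 == 1) s ->
  let P : {poly R} := \prod_(w <- s) (1 + w *: 'X) in
  (1 - 'X^2) * P^`() = ((\sum_(w <- s) w)%:P - (size s)%:R * 'X) * P.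
Proof.
elim: s => [|w s IHs] /=; first by move=> _; rewrite !big_nil derivC; ring.
case/andP=> /eqP w2 /IHs; rewrite !big_cons.
set P := \prod_(_ <- s) _ => IH.
have w2P : w%:P ^+ 2 = 1 by rewrite -rmorphXn w2.
rewrite derivM derivD derivC derivZ derivX -!mul_polyC mulr1 add0r rmorphD /=.
rewrite mulrDr (mulrCA _ _ P^`()) IH mulrS.
have -> : (1 - 'X^2) * (w%:P * P) = (w%:P - 'X) * (1 + w%:P * 'X) * P.
  ring: w2P.
ring.
Qed.

Lemma elem_sym_deriv (R : comNzRingType) (d : nat) (w : 'I_d -> R) :
  (forall i, w i ^+ 2 = 1) ->
  let P : {poly R} := \prod_i (1 + w i *: 'X) in
  (1 - 'X^2) * P^`() = ((\sum_i w i)%:P - d%:R * 'X) * P.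
Proof.
move=> w2; have := @sign_prod_deriv R [seq w i | i <- enum 'I_d].
rewrite size_map size_enum_ord !big_map -!enumT !big_enum /=; apply.
by apply/allP => x /mapP[i _ ->]; rewrite w2.
Qed.

Lemma elem_sym0 (R : comNzRingType) (d : nat) (w : 'I_d -> R) :
  elem_sym 0 w = 1.
Proof.
rewrite /elem_sym (big_pred1 set0) ?big_set0 // => S; exact: cards_eq0.
Qed.

Lemma elem_sym1 (R : comNzRingType) (d : nat) (w : 'I_d -> R) :
  (forall i, w i ^+ 2 = 1) -> elem_sym 1 w = \sum_i w i.
Proof.
move=> /elem_sym_deriv /(congr1 (fun p : {poly R} => p`_0)).
rewrite !mulrBl mul1r !coefB coefCM coefXnM -mulrA mulr_natl coefMn coefXM.
by rewrite mul0rn !subr0 coef_deriv mulr1n -!elem_sym_coef elem_sym0 mulr1.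
Qed.

(** The three-term recurrence of the Krawtchouk polynomials: the coefficient of
    degree [k.+1] in [elem_sym_deriv]. *)
Lemma elem_sym_rec (R : comNzRingType) (d k : nat) (w : 'I_d -> R) :
  (forall i, w i ^+ 2 = 1) ->
  k.+2%:R * elem_sym k.+2 w =
    (\sum_i w i) * elem_sym k.+1 w - (d%:R - k%:R) * elem_sym k w.
Proof.
move=> /elem_sym_deriv /(congr1 (fun p : {poly R} => p`_k.+1)) eqP.
rewrite !mulrBl mul1r !coefB coefCM coefXnM -mulrA mulr_natl coefMn in eqP.
rewrite coefXM !coef_deriv /= -!elem_sym_coef in eqP.
rewrite -(mulr_natl (elem_sym _ _)) in eqP.
case: k eqP => [|k]; first by rewrite /= mulr0n !subr0 !mulr_natl.
rewrite /= !subSS subn0 => /eqP; rewrite subr_eq => /eqP ->.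
by rewrite mulrBl !mulr_natl opprB addrA addrAC.
Qed.

Lemma elem_sym_step (R : numFieldType) (d k : nat) (w : 'I_d -> R) :
  (forall i, w i ^+ 2 = 1) ->
  elem_sym k.+2 w =
    ((\sum_i w i) * elem_sym k.+1 w - (d%:R - k%:R) * elem_sym k w) / k.+2%:R.
Proof. by move=> w2; rewrite -elem_sym_rec // mulrC mulKf ?pnatr_eq0. Qed.

(** On sign vectors of length [d], [elem_sym k] depends only on the sum of the
    entries, and for even [k] only on its square. *)
Definition elem_sym_is (R : comNzRingType) (d k : nat) (phi : R -> R) : Prop :=
  forall w : 'I_d -> R,
    (forall i, w i ^+ 2 = 1) -> elem_sym k w = phi ((\sum_i w i) ^+ 2).

(** The Krawtchouk polynomials of degree 4 and 6 of the cube of dimension [n],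
    in terms of the square [t] of the inner product. *)
Definition kraw4 (R : fieldType) (n t : R) : R :=
  (t ^+ 2 - (6 * n - 8) * t + 3 * n * (n - 2)) / 24.

Definition kraw6 (R : fieldType) (n t : R) : R :=
  (t ^+ 3 - (15 * n - 40) * t ^+ 2 + (45 * n ^+ 2 - 210 * n + 184) * t
    - 15 * n * (n - 2) * (n - 4)) / 720.

Lemma elem_sym4 (R : numFieldType) (d : nat) :
  elem_sym_is d 4 (@kraw4 R d%:R).
Proof.
by move=> w w2; rewrite !elem_sym_step // elem_sym0 elem_sym1 // /kraw4; field.
Qed.

Lemma elem_sym6 (R : numFieldType) (d : nat) :
  elem_sym_is d 6 (@kraw6 R d%:R).
Proof.
by move=> w w2; rewrite !elem_sym_step // elem_sym0 elem_sym1 // /kraw6; field.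
Qed.

(** The kernel splits over the characters: the double sum is
    [\sum_S (\sum_p \prod_(c in S) x p c) ^+ 2]. *)
Lemma elem_sym_psd (R : realDomainType) (d k : nat) (I : finType)
    (x : I -> 'I_d -> R) :
  0 <= \sum_p \sum_q elem_sym k (fun c => x p c * x q c).
Proof.
have -> : \sum_p \sum_q elem_sym k (fun c => x p c * x q c) =
    \sum_(S : {set 'I_d} | #|S| == k) (\sum_p \prod_(c in S) x p c) ^+ 2.
  under eq_bigr do rewrite exchange_big.
  rewrite exchange_big; apply: eq_bigr => S _.
  rewrite expr2 mulr_suml; apply: eq_bigr => p _.
  by rewrite mulr_sumr; apply: eq_bigr => q _; rewrite big_split.
by apply: sumr_ge0 => S _; apply: sqr_ge0.
Qed.

(** * Hadamard and weighing matrices *)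

Lemma hadamard_sqr (R : realType) (d : nat) (H : 'M[R]_d) i j :
  hadamard H -> H i j ^+ 2 = 1.
Proof. by case=> /(_ i j)[] -> _; rewrite ?sqrrN expr1n. Qed.

Lemma weighing_sqr (R : realType) (d l : nat) (W : 'M[R]_d) i j :
  weighing l W -> W i j ^+ 2 = 0 \/ W i j ^+ 2 = 1.
Proof.
by case=> /(_ i j)[] -> _; rewrite ?sqrrN ?expr1n ?expr0n; [left|right|right].
Qed.

Lemma weighing_row (R : realType) (d l : nat) (W : 'M[R]_d) i :
  weighing l W -> \sum_j W i j ^+ 2 = l%:R.
Proof.
case=> _ /matrixP/(_ i i); rewrite !mxE eqxx mulr1n => <-.
by apply: eq_bigr => j _; rewrite mxE expr2.
Qed.

Lemma quasi_unbiased_weighing (R : realType) (d l a : nat) (H1 H2 : 'M[R]_d) :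
  (0 < a)%N -> quasi_unbiased l a H1 H2 ->
  exists2 W : 'M[R]_d, weighing l W & H1 *m H2^T = Num.sqrt a%:R *: W.
Proof.
move=> a_gt0 qu; exists ((Num.sqrt a%:R)^-1 *: (H1 *m H2^T)) => //.
by rewrite scalerA divff ?scale1r // sqrtr_eq0 -ltNge ltr0n.
Qed.

Lemma nth_hadamard (R : realType) (d l a : nat) (Hs : seq 'M[R]_d)
    (g : 'I_(size Hs)) :
  mutually_quasi_unbiased l a Hs -> hadamard Hs`_g.
Proof. by case=> _ hHs _; apply/hHs/mem_nth. Qed.

Lemma nth_quasi_unbiased (R : realType) (d l a : nat) (Hs : seq 'M[R]_d)
    (g h : 'I_(size Hs)) :
  mutually_quasi_unbiased l a Hs -> g != h ->
  quasi_unbiased l a Hs`_g Hs`_h.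
Proof.
by case=> uHs _ qHs gh; apply: qHs; rewrite ?mem_nth // nth_uniq.
Qed.

(** * The Delsarte inequality *)

Definition block_sum (R : comNzRingType) (d k : nat) (H1 H2 : 'M[R]_d) : R :=
  \sum_i \sum_j elem_sym k (fun c => H1 i c * H2 j c).

Lemma block_sumE (R : realType) (d k : nat) (phi : R -> R) (H1 H2 : 'M[R]_d) :
  elem_sym_is d k phi -> hadamard H1 -> hadamard H2 ->
  block_sum k H1 H2 = \sum_i \sum_j phi ((H1 *m H2^T) i j ^+ 2).
Proof.
move=> phiE h1 h2; apply: eq_bigr => i _; apply: eq_bigr => j _.
rewrite phiE => [|c]; last by rewrite exprMn !hadamard_sqr // mulr1.
by congr (phi (_ ^+ 2)); rewrite mxE; apply: eq_bigr => c _; rewrite mxE.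
Qed.

Lemma block_sum_diag (R : realType) (d k : nat) (phi : R -> R) (H : 'M[R]_d) :
  elem_sym_is d k phi -> hadamard H ->
  block_sum k H H = d%:R * (phi (d%:R ^+ 2) + (d%:R - 1) * phi 0).
Proof.
move=> phiE hH; rewrite (block_sumE phiE) // hH.2.
rewrite (eq_bigr (fun=> phi (d%:R ^+ 2) + (d%:R - 1) * phi 0)) => [|i _].
  by rewrite sumr_const card_ord mulr_natl.
have d_gt0 : (0 < d)%N by apply: leq_trans (ltn_ord i).
rewrite (bigD1 i) //= mxE eqxx mulr1n; congr (_ + _).
rewrite (eq_bigr (fun=> phi 0)) => [|j ji].
  rewrite sumr_const cardC1 card_ord -[d in RHS](prednK d_gt0) -natr1 addrK.
  by rewrite mulr_natl.
by rewrite mxE eq_sym (negPf ji) mulr0n expr0n.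
Qed.

Lemma block_sum_offdiag (R : realType) (d k l a : nat) (phi : R -> R)
    (H1 H2 : 'M[R]_d) :
  elem_sym_is d k phi -> (0 < a)%N ->
  hadamard H1 -> hadamard H2 -> quasi_unbiased l a H1 H2 ->
  block_sum k H1 H2 = d%:R * (l%:R * phi a%:R + (d%:R - l%:R) * phi 0).
Proof.
move=> phiE a_gt0 h1 h2 /(quasi_unbiased_weighing a_gt0)[W hW HW].
rewrite (block_sumE phiE) // HW.
rewrite (eq_bigr (fun=> l%:R * phi a%:R + (d%:R - l%:R) * phi 0)) => [|i _].
  by rewrite sumr_const card_ord -[LHS]mulr_natl.
have -> : l%:R * phi a%:R + (d%:R - l%:R) * phi 0 =
    d%:R * phi 0 + l%:R * (phi a%:R - phi 0) by ring.
have -> : d%:R * phi 0 = \sum_(j < d) phi 0.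
  by rewrite sumr_const card_ord mulr_natl.
rewrite -(weighing_row i hW) mulr_suml -big_split /=.
(* As [W i j ^+ 2] is 0 or 1, [phi] is affine on the values that occur. *)
apply: eq_bigr => j _; rewrite mxE exprMn sqr_sqrtr ?ler0n //.
case: (weighing_sqr i j hW) => ->.
  by rewrite mulr0 mul0r addr0.
by rewrite mulr1 mul1r subrKC.
Qed.

(** Positivity of the kernel on all the rows, divided by the number
    [size Hs * d] of rows. *)
Lemma delsarte (R : realType) (d k l a : nat) (phi : R -> R)
    (Hs : seq 'M[R]_d) :
  elem_sym_is d k phi -> (0 < d)%N -> (0 < a)%N -> (0 < size Hs)%N ->
  mutually_quasi_unbiased l a Hs ->
  0 <= phi (d%:R ^+ 2) + (d%:R - 1) * phi 0
     + ((size Hs)%:R - 1) * (l%:R * phi a%:R + (d%:R - l%:R) * phi 0).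
Proof.
move=> phiE d_gt0 a_gt0 Hs_gt0 muHs.
have := elem_sym_psd k (fun (p : 'I_(size Hs) * 'I_d) c => Hs`_p.1 p.2 c).
set A := phi _ + _; set B := l%:R * _ + _.
suff -> : \sum_p \sum_q elem_sym k (fun c => Hs`_(p.1 : 'I_(size Hs)) p.2 c
      * Hs`_(q.1 : 'I_(size Hs)) q.2 c) =
    ((size Hs)%:R * d%:R) * (A + ((size Hs)%:R - 1) * B).
  by rewrite pmulr_rge0 // mulr_gt0 ?ltr0n.
transitivity (\sum_(g < size Hs) \sum_(h < size Hs)
    block_sum k Hs`_g Hs`_h).
  rewrite -(pair_bigA _ (fun (g : 'I_(size Hs)) (i : 'I_d) =>
    \sum_(q : 'I_(size Hs) * 'I_d)
      elem_sym k (fun c => Hs`_g i c * Hs`_q.1 q.2 c))) /=.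
  apply: eq_bigr => g _; rewrite exchange_big /=.
  rewrite -(pair_bigA _ (fun (h : 'I_(size Hs)) (j : 'I_d) =>
    \sum_i elem_sym k (fun c => Hs`_g i c * Hs`_h j c))) /=.
  by apply: eq_bigr => h _; rewrite exchange_big.
rewrite (eq_bigr (fun=> d%:R * (A + ((size Hs)%:R - 1) * B))) => [|g _].
  by rewrite sumr_const card_ord -[LHS]mulr_natl mulrA.
have hHs h := nth_hadamard h muHs.
rewrite (bigD1 g) //= (block_sum_diag phiE) // [RHS]mulrDr; congr (_ + _).
rewrite (eq_bigr (fun=> d%:R * B)) => [|h hneg].
  rewrite sumr_const cardC1 card_ord -[in RHS](prednK Hs_gt0) -natr1 addrK.
  by rewrite [RHS]mulrCA [RHS]mulr_natl.
apply: block_sum_offdiag => //.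
by apply: nth_quasi_unbiased => //; rewrite eq_sym.
Qed.

Lemma delsarte_bound (R : realType) (d k l a b : nat) (phi : R -> R)
    (Hs : seq 'M[R]_d) :
  elem_sym_is d k phi -> (0 < d)%N -> (0 < a)%N ->
  l%:R * phi a%:R + (d%:R - l%:R) * phi 0 < 0 ->
  phi (d%:R ^+ 2) + (d%:R - 1) * phi 0
     + b%:R * (l%:R * phi a%:R + (d%:R - l%:R) * phi 0) < 0 ->
  mutually_quasi_unbiased l a Hs -> (size Hs <= b)%N.
Proof.
move=> phiE d_gt0 a_gt0 B_lt0 AB_lt0 muHs; rewrite leqNgt; apply/negP => bHs.
have := delsarte phiE d_gt0 a_gt0 (leq_ltn_trans (leq0n b) bHs) muHs.
rewrite leNgt => /negP; apply; apply: le_lt_trans AB_lt0.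
rewrite lerD2l; apply: ler_wnM2r; rewrite ?(ltW B_lt0) //.
by rewrite lerBrDr natr1 ler_nat.
Qed.

(** * Weight four *)

(** Row [i] of [H] is half the signed sum of the four rows of [K] that are not
    orthogonal to it; one of these signed rows has the wrong sign at [p]. *)
Lemma weight4_neighbour (R : realType) (d a : nat) (H K : 'M[R]_d)
    (i p : 'I_d) :
  (0 < a)%N -> (4 * a = d ^ 2)%N -> hadamard H -> hadamard K ->
  quasi_unbiased 4 a H K ->
  exists u : R * 'I_d, let v := u.1 *: row u.2 K in
    [/\ u.1 ^+ 2 = 1, v 0 p = - H i p & (v *m H^T) 0 i = d%:R / 2].
Proof.
move=> a_gt0 a_eq hH hK /(quasi_unbiased_weighing a_gt0)[W hW HW].
have d_gt0 : (0 < d)%N by apply: leq_trans (ltn_ord i).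
have sqrt_a : Num.sqrt a%:R = d%:R / 2 :> R.
  have -> : a%:R = (d%:R / 2) ^+ 2 :> R.
    have := congr1 (fun n => n%:R : R) a_eq; rewrite natrM natrX => E.
    by rewrite expr_div_n -E; field.
  by rewrite sqrtr_sqr ger0_norm // divr_ge0 ?ler0n.
have expansion : \sum_j W i j * K j p * H i p = 2.
  have KK : K^T *m K = d%:R%:M.
    have : ((d%:R)^-1 *: K^T) *m K = 1%:M.
      apply: mulmx1C; rewrite -scalemxAr hK.2 -mul_scalar_mx -scalar_mxM.
      by rewrite mulVf // pnatr_eq0 -lt0n.
    rewrite -scalemxAl => /(congr1 (fun M => d%:R *: M)).
    by rewrite scalerA divff ?scale1r ?scalemx1 // pnatr_eq0 -lt0n.
  have : H *m K^T *m K = d%:R *: H by rewrite -mulmxA KK mul_mx_scalar.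
  move=> /matrixP/(_ i p); rewrite HW -scalemxAl !mxE sqrt_a => E.
  have {}E : \sum_j W i j * K j p = 2 * H i p.
    apply: (mulfI (x := d%:R / 2)); last by rewrite E; field.
    by rewrite mulf_neq0 ?invr_eq0 ?pnatr_eq0 -?lt0n.
  by rewrite -mulr_suml E -mulrA -expr2 hadamard_sqr // mulr1.
have /existsP[j /eqP Wj] : [exists j, W i j * K j p == - H i p].
  case: existsP => // noj; exfalso.
  (* Without a disagreement the sum would be the weight 4 instead of 2. *)
  suff : \sum_j W i j * K j p * H i p = \sum_j W i j ^+ 2.
    by rewrite expansion (weighing_row i hW) => /eqP; rewrite eqr_nat.
  apply: eq_bigr => j _; have : W i j * K j p != - H i p.
    by apply/negP => Wj; apply: noj; exists j.
  case: (hW.1 i j) => ->; case: (hK.1 j p) => ->; case: (hH.1 i p) => -> /eqP;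
    by [move=> _; ring | case; ring].
have Wj2 : W i j ^+ 2 = 1.
  case: (weighing_sqr i j hW) => // /eqP.
  rewrite sqrf_eq0 => /eqP W0; move: Wj; rewrite W0 mul0r => /eqP.
  rewrite eq_sym oppr_eq0 => /eqP Hip; have := hadamard_sqr i p hH.
  by rewrite Hip expr0n => /esym/eqP; rewrite oner_eq0.
exists (W i j, j); split => //=; first by rewrite !mxE.
rewrite -scalemxAl mxE -row_mul mxE.
have -> : (K *m H^T) j i = (H *m K^T) i j.
  by rewrite -[K in LHS]trmxK -trmx_mul mxE.
by rewrite HW mxE mulrCA -expr2 Wj2 mulr1.
Qed.

Lemma equiangular_size (R : numFieldType) (m d : nat) (c : R)
    (V : 'M[R]_(m, d)) :
  c != 0 -> V *m V^T = c%:M + const_mx c -> (m <= d)%N.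
Proof.
(* With [J] the all-ones matrix, [J ^+ 2 = m J], so that
   [(1 + J) (1 - J / (m + 1)) = 1] and [V] has a right inverse. *)
move=> c0 VV; pose e : R := m.+1%:R^-1.
have : V *m (V^T *m (c^-1 *: (1%:M - const_mx e))) = 1%:M.
  rewrite mulmxA VV -scalemxAr; apply/matrixP => i j.
  rewrite mulmxBr mulmx1 !mxE.
  rewrite (eq_bigr (fun k => c * e * (i == k)%:R + c * e)) => [|k _]; last first.
    by rewrite !mxE -mulr_natr; ring.
  rewrite big_split /= -mulr_sumr sumr_const card_ord.
  rewrite (bigD1 i) //= eqxx big1 => [|k ki]; last by rewrite eq_sym (negPf ki).
  rewrite /e /= mulr1n addr0 mulr1 -(mulr_natr c (i == j)) -(mulr_natr _ m).
  rewrite -[m.+1%:R]natr1; field.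
  by rewrite c0 natr1 pnatr_eq0.
exact: mulmx1_min.
Qed.

Lemma weight4_bound (R : realType) (d a : nat) (Hs : seq 'M[R]_d) :
  (0 < d)%N -> (4 * a = d ^ 2)%N -> mutually_quasi_unbiased 4 a Hs ->
  (size Hs <= d.+1)%N.
Proof.
move=> d_gt0 a_eq muHs.
have a_gt0 : (0 < a)%N by rewrite -(ltn_pmul2l (m := 4)) // a_eq expn_gt0 d_gt0.
have [-> //|Hs_gt0] := posnP (size Hs).
case: d d_gt0 a_eq Hs muHs Hs_gt0 => // d _ a_eq Hs muHs Hs_gt0.
pose g0 : 'I_(size Hs) := Ordinal Hs_gt0; pose H := Hs`_g0.
have hHs (g : 'I_(size Hs)) : hadamard Hs`_g := nth_hadamard g muHs.
rewrite -(prednK Hs_gt0) ltnS.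
have lt_succ (j : 'I_(size Hs).-1) : (j.+1 < size Hs)%N.
  by rewrite -ltn_predRL.
pose K (j : 'I_(size Hs).-1) := Hs`_(Ordinal (lt_succ j)).
have quHK j : quasi_unbiased 4 a H (K j).
  exact: (@nth_quasi_unbiased _ _ _ _ _ g0 (Ordinal (lt_succ j))).
(* The row and the coordinate that all the vectors [v j] refer to are 0. *)
have [u hu] := fin_all_exists (fun j => @weight4_neighbour R _ a H (K j) 0 0
  a_gt0 a_eq (hHs _) (hHs _) (quHK j)).
pose v j : 'rV[R]_d.+1 := (u j).1 *: row (u j).2 (K j).
have u_sqr j : (u j).1 ^+ 2 = 1 by case: (hu j).
have v0 j : v j 0 0 = - H 0 0 by case: (hu j).
have vE j c : v j 0 c = (u j).1 * K j (u j).2 c by rewrite !mxE.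
have v_sqr j c : v j 0 c ^+ 2 = 1.
  by rewrite vE exprMn u_sqr (hadamard_sqr _ _ (hHs _)) mulr1.
have dot_v i j : \sum_c v i 0 c * v j 0 c =
    (u i).1 * (u j).1 * (K i *m (K j)^T) (u i).2 (u j).2.
  rewrite mxE mulr_sumr; apply: eq_bigr => c _; rewrite !vE mxE; ring.
have v_self j : \sum_c v j 0 c * v j 0 c = d.+1%:R.
  by rewrite dot_v -expr2 u_sqr (hHs _).2 mxE eqxx mul1r.
have v_H j : \sum_c v j 0 c * H 0 c = d.+1%:R / 2.
  case: (hu j) => _ _ <-; rewrite mxE; apply: eq_bigr => c _.
  by rewrite -/(v j) [H^T _ _]mxE.
have H_self : \sum_c H 0 c * H 0 c = d.+1%:R.
  have /matrixP/(_ 0 0) := (hHs g0).2.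
  rewrite mxE [in RHS]mxE eqxx mulr1n => <-.
  by apply: eq_bigr => c _; rewrite [H^T _ _]mxE.
have v_pos i j : 0 < \sum_c v i 0 c * v j 0 c.
  (* The entries of [H - v i] are 0 or twice those of [H], so all terms are
     nonnegative, and the term at coordinate 0 is 4. *)
  have : 4 <= \sum_c (H 0 c - v i 0 c) * (H 0 c - v j 0 c).
    rewrite (bigD1 0) //= [X in 4 <= X + _](_ : _ = 4); last first.
      rewrite !v0; have := hadamard_sqr 0 0 (hHs g0); rewrite expr2 => E.
      by ring: E.
    rewrite lerDl sumr_ge0 // => c _.
    have /eqP := v_sqr i c; rewrite sqrf_eq1 => /orP[] /eqP ->;
    have /eqP := v_sqr j c; rewrite sqrf_eq1 => /orP[] /eqP ->;
    by case: ((hHs g0).1 0 c) => ->; lra.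
  under eq_bigr do rewrite mulrBl !mulrBr (mulrC (H _ _) (v _ _ _)).
  by rewrite !sumrB H_self !v_H; lra.
apply: (@equiangular_size R _ _ (d.+1%:R / 2) (\matrix_j v j)).
  by rewrite mulf_neq0 ?invr_eq0 ?pnatr_eq0.
apply/matrixP => i j.
have -> : ((\matrix_j v j) *m (\matrix_j v j)^T) i j =
    \sum_c v i 0 c * v j 0 c.
  by rewrite mxE; apply: eq_bigr => c _; rewrite mxE [in X in _ * X]mxE mxE.
rewrite !mxE; case: (eqVneq i j) => [->|ij].
  by rewrite v_self mulr1n; field.
rewrite mulr0n add0r.
have quK : quasi_unbiased 4 a (K i) (K j).
  exact: (@nth_quasi_unbiased _ _ _ _ _
    (Ordinal (lt_succ i)) (Ordinal (lt_succ j))).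
have [W hW HW] := quasi_unbiased_weighing a_gt0 quK.
have sqr_dot : (\sum_c v i 0 c * v j 0 c) ^+ 2 = a%:R * W (u i).2 (u j).2 ^+ 2.
  by rewrite dot_v HW mxE !exprMn !u_sqr !mul1r sqr_sqrtr ?ler0n.
have := v_pos i j; move: sqr_dot; set D := \sum_c _ => + D_gt0.
case: (weighing_sqr (u i).2 (u j).2 hW) => ->.
  by rewrite mulr0 => /eqP; rewrite sqrf_eq0 gt_eqF.
have -> : a%:R * 1 = (d.+1%:R / 2) ^+ 2 :> R.
  have := congr1 (fun n => n%:R : R) a_eq; rewrite natrM natrX => E.
  by rewrite expr_div_n -E; field.
move=> /eqP; rewrite eqrXn2 // ?ltW // => [/eqP //|].
by rewrite divr_gt0 ?ltr0n.
Qed.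

(** * The entries of the linear programming columns *)

Lemma sqr_alpha (R : realType) (l : nat) :
  (Num.sqrt l%:R)^-1 ^+ 2 = l%:R^-1 :> R.
Proof. by rewrite exprVn sqr_sqrtr ?ler0n. Qed.

Lemma exp4_alpha (R : realType) (l : nat) :
  (Num.sqrt l%:R)^-1 ^+ 4 = l%:R^-1 ^+ 2 :> R.
Proof. by rewrite (exprM _ 2 2) sqr_alpha. Qed.

Lemma LP1_entry_some (R : realType) (d l b : nat) (t := l%:R^-1 : R) :
  (0 < d)%N ->
  (d%:R + 4) * t <= 6 -> (d%:R + 2) * t < 3 ->
  b%:R * (3 - (d%:R + 2) * t) <= (d%:R + 2) * (1 - t) ->
  (d%:R + 2) * (1 - t) < b.+1%:R * (3 - (d%:R + 2) * t) ->
  LP1_entry R d l = Some b.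
Proof.
move=> d_gt0 c1 c2 lo hi.
rewrite /LP1_entry /LP1_cond /LP1_bound sqr_alpha -/t c1 c2 /=; congr Some.
have D_gt0 : 0 < 3 - (d%:R + 2) * t by rewrite subr_gt0.
have d0 : d%:R != 0 :> R by rewrite pnatr_eq0 -lt0n.
rewrite [X in Num.truncn X](_ : _ =
    (d%:R + 2) * (1 - t) / (3 - (d%:R + 2) * t)); last first.
  by field; rewrite d0 gt_eqF.
apply/eqP; rewrite truncn_eq; first by rewrite ler_pdivlMr // ltr_pdivrMr // lo.
by apply: le_trans (ler0n _ b) _; rewrite ler_pdivlMr.
Qed.

Lemma LP1_entry_none (R : realType) (d l : nat) (t := l%:R^-1 : R) :
  3 <= (d%:R + 2) * t -> LP1_entry R d l = None.
Proof.
rewrite /LP1_entry /LP1_cond sqr_alpha -/t => c.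
by rewrite [_ < 3]ltNge c andbF.
Qed.

Lemma LP2_entry_some (R : realType) (d l b : nat) (t := l%:R^-1 : R)
    (D := (d%:R + 4) * (d%:R + 8) * t ^+ 2 - 15 * (d%:R + 4) * t + 30)
    (N := (d%:R + 4) * ((1 - t) * (15 - (d%:R + 8) * (1 + t)))) :
  (0 < d)%N ->
  (d%:R + 6) * (d%:R + 8) * t ^+ 2 - 15 * (d%:R + 6) * t + 45 <= 0 ->
  D < 0 -> N <= b%:R * D -> b.+1%:R * D < N ->
  LP2_entry R d l = Some b.
Proof.
move=> d_gt0 c1 c2 lo hi.
rewrite /LP2_entry /LP2_cond /LP2_bound exp4_alpha sqr_alpha -/t c1 c2 /=.
congr Some; have d0 : d%:R != 0 :> R by rewrite pnatr_eq0 -lt0n.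
rewrite [X in Num.truncn X](_ : _ = N / D); last first.
  by rewrite /N -/D; field; rewrite d0 lt_eqF.
apply/eqP; rewrite truncn_eq; first by rewrite ler_ndivlMr // ltr_ndivrMr // lo.
by apply: le_trans (ler0n _ b) _; rewrite ler_ndivlMr.
Qed.

Lemma LP2_entry_none (R : realType) (d l : nat) (t := l%:R^-1 : R) :
  0 < (d%:R + 6) * (d%:R + 8) * t ^+ 2 - 15 * (d%:R + 6) * t + 45 \/
  0 <= (d%:R + 4) * (d%:R + 8) * t ^+ 2 - 15 * (d%:R + 4) * t + 30 ->
  LP2_entry R d l = None.
Proof.
rewrite /LP2_entry /LP2_cond exp4_alpha sqr_alpha -/t => -[] c.
  by rewrite [_ <= 0]leNgt c.
by rewrite [_ < 0]ltNge c andbF.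
Qed.

Lemma table_LP1 (R : realType) (d l a known : nat) (lp1 lp2 : option nat)
    (sdp : nat) :
  (d, l, a, known, lp1, lp2, sdp) \in bound_table -> LP1_entry R d l = lp1.
Proof.
rewrite /bound_table !inE; do 10?case/orP.
all: case/eqP=> -> -> _ _ -> _ _.
all: by [apply: LP1_entry_none; lra | apply: LP1_entry_some => //; lra].
Qed.

Lemma table_LP2 (R : realType) (d l a known : nat) (lp1 lp2 : option nat)
    (sdp : nat) :
  (d, l, a, known, lp1, lp2, sdp) \in bound_table -> LP2_entry R d l = lp2.
Proof.
rewrite /bound_table !inE; do 10?case/orP.
all: case/eqP=> -> -> _ _ _ -> _.
all: by [apply: LP2_entry_none; lra | apply: LP2_entry_some => //; lra].
Qed.

(** * The bounds on the number of matrices *)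

(** The bound [sdp] stands in for a blank linear programming entry. *)
Lemma table_size_bound (R : realType) (d l a known : nat)
    (lp1 lp2 : option nat) (sdp : nat)
    (Hs : seq 'M[R]_d) :
  (d, l, a, known, lp1, lp2, sdp) \in bound_table ->
  mutually_quasi_unbiased l a Hs ->
  (size Hs <=
    minn (minn known sdp) (minn (odflt sdp lp1) (odflt sdp lp2)))%N.
Proof.
move=> row_in muHs.
have D4 b := @delsarte_bound R d 4 l a b (kraw4 d%:R) Hs (@elem_sym4 R d).
have D6 b := @delsarte_bound R d 6 l a b (kraw6 d%:R) Hs (@elem_sym6 R d).
rewrite /kraw4 /kraw6 in D4 D6.
move: row_in; rewrite /bound_table !inE; do 10?case/orP.
all: case/eqP => *; subst d l a known lp1 lp2 sdp.
- by change (size Hs <= 15)%N; apply: D6 => //; lra.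
- by change (size Hs <= 25)%N; apply: D6 => //; lra.
- by change (size Hs <= 85)%N; apply: D4 => //; lra.
- by change (size Hs <= 47)%N; apply: D6 => //; lra.
- by change (size Hs <= 79)%N; apply: D6 => //; lra.
- by change (size Hs <= 101)%N; apply: D6 => //; lra.
- by change (size Hs <= 28)%N; apply: D4 => //; lra.
- exact: leq_trans (weight4_bound _ _ muHs) _.
- by change (size Hs <= 104)%N; apply: D6 => //; lra.
- by change (size Hs <= 316)%N; apply: D6 => //; lra.
- by change (size Hs <= 28)%N; apply: D4 => //; lra.
Qed.

Unset Implicit Arguments.

Theorem theorem6p1 (R : realType) (d l a f : nat)
    (known : nat) (lp1 lp2 : option nat) (sdp : nat)
    (d_gt0 : (0 < d)%N) (l_gt0 : (0 < l)%N)
    (f_max : max_quasi_unbiased R d l a f)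
    (row_in : (d, l, a, known, lp1, lp2, sdp) \in bound_table) :
  (lp1 = LP1_entry R d l /\ lp2 = LP2_entry R d l) /\
  [/\ (f <= known)%N,
      (forall b, lp1 = Some b -> (f <= b)%N),
      (forall b, lp2 = Some b -> (f <= b)%N)
    & (f <= sdp)%N].
Proof.
split; first by rewrite (table_LP1 R row_in) (table_LP2 R row_in).
have [[Hs muHs <-] _] := f_max.
have := table_size_bound row_in muHs.
rewrite !leq_min => /andP[/andP[le_known le_sdp] /andP[le_lp1 le_lp2]].
by split=> // b eq_b; rewrite eq_b in le_lp1 le_lp2.
Qed.
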